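(* Let $(r_k)_{k\ge 1}$, $(s_k)_{k\ge 0}$, $(t_k)_{k\ge 1}$ be sequences of nonnegative real numbers, let $A=[a_{n,k}]_{n,k\ge 0}$ be the recursive matrix corresponding to these sequences, and let $J$ be its coefficient matrix. (i) For every positive integer $r$, if $J$ is TP$_r$, then $A$ is TP$_r$; likewise, if $J$ is TP, then $A$ is TP. (ii) If $A$ is TP$_2$, then the sequence $(a_{n,0})_{n\ge 0}$ is log-convex.
   Context: All matrices are real. A (finite or infinite) matrix is TP$_r$ (totally positive of order $r$) if all its minors of all orders $\le r$ are nonnegative; it is TP (totally positive) if its minors of all orders are nonnegative. The recursive matrix corresponding to nonnegative sequences $(r_k)_{k\ge1},(s_k)_{k\ge0},(t_k)_{k\ge1}$ is the infinite lower triangular matrix $A=[a_{n,k}]_{n,k\ge 0}$ with $a_{n,k}=0$ unless $n\ge k\ge 0$, defined by $a_{0,0}=1$, $a_{n+1,0}=s_0a_{n,0}+t_1a_{n,1}$, and $a_{n+1,k}=r_ka_{n,k-1}+s_ka_{n,k}+t_{k+1}a_{n,k+1}$ for $k\ge 1$, $n\ge 0$. The numbers $a_{n,0}$ are called its Catalan-like numbers. Its coefficient matrix is the infinite tridiagonal matrix $J=[J_{i,j}]_{i,j\ge 0}$ with $J_{k,k}=s_k$ for $k\ge0$, $J_{k-1,k}=r_k$ and $J_{k,k-1}=t_k$ for $k\ge 1$, and all other entries $0$. A sequence $(a_n)_{n\ge 0}$ of nonnegative numbers is log-convex if $a_ia_{j+1}\ge a_{i+1}a_j$ for all $0\le i<j$.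 *)

(* Defs.v *)
From mathcomp Require Import all_boot all_order all_algebra.
From mathcomp Require Import reals.

Set Implicit Arguments.
Unset Strict Implicit.
Unset Printing Implicit Defensive.

Import Order.TTheory GRing.Theory Num.Theory.
Local Open Scope ring_scope.

(* An infinite matrix is a function [nat -> nat -> R]. *)
Definition minor (R : realType) (A : nat -> nat -> R) (m : nat)
    (rows cols : 'I_m -> nat) : R :=
  \det (\matrix_(i < m, j < m) A (rows i) (cols j)).

Definition increasing (m : nat) (f : 'I_m -> nat) : Prop :=
  forall i j : 'I_m, (i < j)%N -> (f i < f j)%N.

(* The empty minor (m = 0) equals 1, so allowing it imposes nothing. *)
Definition TP_upto (R : realType) (q : nat) (A : nat -> nat -> R) : Prop :=
  forall (m : nat) (rows cols : 'I_m -> nat), (m <= q)%N ->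
    increasing rows -> increasing cols -> 0 <= minor A rows cols.

Definition TP (R : realType) (A : nat -> nat -> R) : Prop :=
  forall (m : nat) (rows cols : 'I_m -> nat),
    increasing rows -> increasing cols -> 0 <= minor A rows cols.

(* The sequences r and t start at index 1: the values [r 0] and [t 0] are never
   used. Row 0 is (1, 0, 0, ...); the lower triangular shape then follows from
   the recurrence, see [recursive_mx_gt] below. *)
Fixpoint recursive_mx (R : realType) (r s t : nat -> R) (n k : nat) : R :=
  match n, k with
  | 0, 0 => 1
  | 0, _.+1 => 0
  | n'.+1, 0 => s 0%N * recursive_mx r s t n' 0%N
               + t 1%N * recursive_mx r s t n' 1%N
  | n'.+1, k'.+1 =>
      r k * recursive_mx r s t n' k' + s k * recursive_mx r s t n' k
      + t k.+1 * recursive_mx r s t n' k.+1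
  end.

Lemma recursive_mx_gt (R : realType) (r s t : nat -> R) (n k : nat) :
  (n < k)%N -> recursive_mx r s t n k = 0.
Proof.
elim: n k => [|n IHn] [|k] //= lt_nk.
rewrite (IHn k) // (IHn k.+1) ?(IHn k.+2) ?mulr0 ?addr0 //.
  by rewrite ltnS ltnW // ltnW.
by rewrite ltnS ltnW.
Qed.

Definition coefficient_mx (R : realType) (r s t : nat -> R) (i j : nat) : R :=
  if i == j then s i
  else if j == i.+1 then r j
  else if i == j.+1 then t i
  else 0.

Definition log_convex (R : realType) (a : nat -> R) : Prop :=
  (forall n : nat, 0 <= a n) /\
  (forall i j : nat, (i < j)%N -> a i.+1 * a j <= a i * a j.+1).

(* Main.v *)
Require Import Defs.
From mathcomp Require Import all_boot all_order all_algebra.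
From mathcomp Require Import perm.
From mathcomp Require Import reals.

Set Implicit Arguments.
Unset Strict Implicit.
Unset Printing Implicit Defensive.

Import Order.TTheory GRing.Theory Num.Theory.
Local Open Scope ring_scope.

(** Deleting row 0 of the recursive matrix [A] gives [A * J]. By the
    Cauchy-Binet formula, a minor of [A] whose rows all have positive index is
    therefore a sum of products of a minor of [A], whose rows have been shifted
    up by one, and a minor of [J] of the same order. Since row 0 of [A] is
    [(1, 0, 0, ...)], a minor that uses row 0 either vanishes or equals the
    minor obtained by dropping row 0 and column 0, all of whose rows have
    positive index. Induction on a bound for the row indices
    ([minor_recursive_mx_ge0]) then proves (i).

    Only the sign of the minors matters, so Cauchy-Binet is used in the
    symmetrized form [cauchy_binet_fact]: [m! det (A B)] is the sum over all
    maps [f : 'I_m -> 'I_n], increasing or not, of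
    [det (A restricted to columns f) * det (B restricted to rows f)]. A
    non-injective [f] contributes 0, and sorting an injective [f] multiplies
    both factors by the same sign, so every term is nonnegative as soon as the
    minors of [A] and [B] with increasing indices are.

    For (ii), the recurrence for column 0 gives
    [a_{i,0} a_{j+1,0} - a_{i+1,0} a_{j,0}
       = t_1 (a_{i,0} a_{j,1} - a_{i,1} a_{j,0})],
    which is [t_1] times a minor of order 2. *)

(** * The Cauchy-Binet formula *)

Lemma det_row_perm (R : comPzRingType) (m : nat) (s : 'S_m) (M : 'M[R]_m) :
  \det (row_perm s M) = (-1) ^+ s * \det M.
Proof. by rewrite row_permE det_mulmx det_perm. Qed.

Lemma det_col_perm (R : comPzRingType) (m : nat) (s : 'S_m) (M : 'M[R]_m) :
  \det (col_perm s M) = (-1) ^+ s * \det M.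
Proof. by rewrite -det_tr tr_col_perm det_row_perm det_tr. Qed.

Lemma det_mulmx_expand (R : comPzRingType) (m n : nat)
    (A : 'M[R]_(m, n)) (B : 'M[R]_(n, m)) :
  \det (A *m B) =
  \sum_(f : {ffun 'I_m -> 'I_n}) (\prod_i A i (f i)) * \det (rowsub f B).
Proof.
under [RHS]eq_bigr => f _ do rewrite /determinant mulr_sumr.
rewrite exchange_big; apply: eq_bigr => /= s _.
under eq_bigr => i _ do rewrite mxE.
rewrite bigA_distr_bigA mulr_sumr /=; apply: eq_bigr => f _.
rewrite big_split /= mulrCA; congr (_ * (_ * _)).
by apply: eq_bigr => i _; rewrite !mxE.
Qed.

(** Cauchy-Binet, summed over all maps instead of the increasing ones: each
    set of [m] indices is then counted [m!] times. *)
Lemma cauchy_binet_fact (R : comPzRingType) (m n : nat)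
    (A : 'M[R]_(m, n)) (B : 'M[R]_(n, m)) :
  \det (A *m B) *+ m`! =
  \sum_(f : {ffun 'I_m -> 'I_n}) \det (colsub f A) * \det (rowsub f B).
Proof.
rewrite -card_Sn -sumr_const.
under [RHS]eq_bigr => f _ do rewrite {1}/determinant mulr_suml.
rewrite [RHS]exchange_big /=; apply: eq_big => [s|s _]; first by rewrite inE.
(* Composing f with s multiplies the determinant of the rows f of B by the
   sign of s. *)
pose h (u : 'S_m) (f : {ffun 'I_m -> 'I_n}) := [ffun i => f (u i)].
have h_bij : {on [pred _ | true], bijective (h s)}.
  by exists (h s^-1%g) => f _; apply/ffunP => i; rewrite !ffunE ?permK ?permKV.
rewrite det_mulmx_expand (reindex _ h_bij) /=; apply: eq_bigr => f _.
have -> : rowsub (h s f) B = row_perm s (rowsub f B).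
  by apply/matrixP => i j; rewrite !mxE ffunE.
rewrite det_row_perm mulrCA -mulrA; congr (_ * (_ * _)).
by apply: eq_bigr => i _; rewrite mxE ffunE.
Qed.

(** * Sums of products of minors *)

Lemma injective_sort (m : nat) (f : 'I_m -> nat) :
  injective f -> exists s : 'S_m, increasing (fun i => f (s i)).
Proof.
move=> f_inj; pose u := [tuple f i | i < m].
have /tuple_permP[s def_u] : perm_eq (sort leq u) u by rewrite perm_sort.
exists s => i j lt_ij.
have nthE (k : 'I_m) : nth 0%N (sort leq u) k = f (s k).
  by rewrite def_u -tnth_nth !tnth_mktuple.
have: sorted ltn (sort leq u).
  rewrite ltn_sorted_uniq_leq sort_uniq sort_sorted ?andbT; last exact: leq_total.
  by rewrite map_inj_uniq ?enum_uniq.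
move=> /(sorted_ltn_nth ltn_trans 0%N) /(_ i j).
by rewrite !inE size_sort size_tuple !ltn_ord !nthE; apply.
Qed.

Lemma minor_row_noninj (R : realType) (A : nat -> nat -> R) (m : nat)
    (rows cols : 'I_m -> nat) :
  ~~ injectiveb rows -> minor A rows cols = 0.
Proof.
case/injectivePn=> i [j ne_ij eq_ij].
apply: (determinant_alternate ne_ij) => k.
by rewrite !mxE eq_ij.
Qed.

(** No order is assumed on [f]: if [f] is injective, sorting it multiplies both
    minors by the same sign, and otherwise both minors vanish. *)
Lemma minor_mul_ge0 (R : realType) (A B : nat -> nat -> R) (m : nat)
    (rows cols f : 'I_m -> nat) :
    (forall g, increasing g -> 0 <= minor A rows g) ->
    (forall g, increasing g -> 0 <= minor B g cols) ->
  0 <= minor A rows f * minor B f cols.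
Proof.
move=> A_ge0 B_ge0.
have [f_inj|f_ninj] := boolP (injectiveb f); last first.
  by rewrite (minor_row_noninj _ _ f_ninj) mulr0.
have [s incr_fs] := injective_sort (injectiveP _ f_inj).
have := mulr_ge0 (A_ge0 _ incr_fs) (B_ge0 _ incr_fs); rewrite /minor.
have <- : col_perm s (\matrix_(i, j) A (rows i) (f j)) =
          \matrix_(i, j) A (rows i) (f (s j)).
  by apply/matrixP => i j; rewrite !mxE.
have <- : row_perm s (\matrix_(i, j) B (f i) (cols j)) =
          \matrix_(i, j) B (f (s i)) (cols j).
  by apply/matrixP => i j; rewrite !mxE.
by rewrite det_row_perm det_col_perm mulrACA -expr2 sqrr_sign mul1r.
Qed.

(** The rows [rows'] of [C] are the product of the rows [rows] of [A] by [B];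
    the hypothesis bears on these rows only, so that [C] may be [A] with its
    rows shifted. *)
Lemma minor_prod_ge0 (R : realType) (A B C : nat -> nat -> R) (N m : nat)
    (rows rows' cols : 'I_m -> nat) :
    (forall i k, C (rows' i) k = \sum_(j < N) A (rows i) j * B j k) ->
    (forall g, increasing g -> 0 <= minor A rows g) ->
    (forall g, increasing g -> 0 <= minor B g cols) ->
  0 <= minor C rows' cols.
Proof.
move=> C_AB A_ge0 B_ge0.
have -> : minor C rows' cols =
    \det ((\matrix_(i < m, j < N) A (rows i) j) *m
          (\matrix_(i < N, j < m) B i (cols j))).
  congr (\det _); apply/matrixP => i k; rewrite !mxE C_AB.
  by apply: eq_bigr => j _; rewrite !mxE.
rewrite -(pmulrn_lge0 _ (fact_gt0 m)) cauchy_binet_fact sumr_ge0 // => f _.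
have <- : minor A rows (fun i => f i) =
    \det (colsub f (\matrix_(i, j) A (rows i) j)).
  by congr (\det _); apply/matrixP => i j; rewrite !mxE.
have <- : minor B (fun i => f i) cols =
    \det (rowsub f (\matrix_(i, j) B i (cols j))).
  by congr (\det _); apply/matrixP => i j; rewrite !mxE.
exact: minor_mul_ge0.
Qed.

(** * Recursive matrices *)

Lemma sum_ord_pick (V : nmodType) (N k : nat) (F : nat -> V) :
    (forall j, (N <= j)%N -> F j = 0) ->
  \sum_(j < N) (if (j : nat) == k then F j else 0) = F k.
Proof.
move=> F0; rewrite -big_mkcond /=.
have [lt_kN|le_Nk] := ltnP k N.
  by rewrite (big_pred1 (Ordinal lt_kN)).
rewrite big_pred0 ?F0 // => j; apply: contraTF le_Nk => /eqP <-.
by rewrite -ltnNge.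
Qed.

(** The matrix [A] without its row 0 is [A * J]; as [A] is lower triangular,
    the entry in row [n.+1] is a finite sum. *)
Lemma recursive_mxS (R : realType) (r s t : nat -> R) (N n k : nat) :
    (n < N)%N ->
  recursive_mx r s t n.+1 k =
  \sum_(j < N) recursive_mx r s t n j * coefficient_mx r s t j k.
Proof.
move=> lt_nN; set a := recursive_mx r s t n.
have a0 j : (N <= j)%N -> a j = 0.
  by move=> le_Nj; apply: recursive_mx_gt; apply: leq_trans le_Nj.
have pick (l : nat) (c : R) :
    \sum_(j < N) (if (j : nat) == l then a j * c else 0) = a l * c.
  by apply: (sum_ord_pick _ (F := fun j => a j * c)) => j /a0 ->; rewrite mul0r.
case: k => [|k] /=; rewrite -/a.
  rewrite [s 0%N * _]mulrC [t 1%N * _]mulrC -2!pick -big_split /=.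
  apply: eq_bigr => -[[|[|j]] lt_jN] _ /=;
    by rewrite /coefficient_mx /= ?mulr0 ?addr0 ?add0r.
rewrite [r _ * _]mulrC [s _ * _]mulrC [t _ * _]mulrC -3!pick -!big_split /=.
apply: eq_bigr => j _; rewrite /coefficient_mx eqSS.
have [->|_] := eqVneq (j : nat) k.+1.
  by rewrite (gtn_eqF (ltnSn k)) (ltn_eqF (ltnSn k.+1)) add0r addr0.
rewrite [(j : nat) == k]eq_sym; have [->|_] := eqVneq k (j : nat).
  by rewrite (ltn_eqF (ltnW (ltnSn j.+1))) !addr0.
by have [->|_] := eqVneq (j : nat) k.+2; rewrite !add0r ?mulr0.
Qed.

(** By induction on the bound [n] for the row indices. *)
Lemma minor_recursive_mx_ge0 (R : realType) (r s t : nat -> R) (q n m : nat)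
    (rows cols : 'I_m -> nat) :
    TP_upto q (coefficient_mx r s t) -> (m <= q)%N ->
    (forall i, rows i < n)%N -> increasing rows -> increasing cols ->
  0 <= minor (recursive_mx r s t) rows cols.
Proof.
move=> J_TP; elim: n m rows cols => [|n IHn] m rows cols le_mq.
  case: m rows cols le_mq => [|m] rows cols _ lt_rows0 _ _.
    by rewrite /minor det_mx00 ler01.
  by have := lt_rows0 ord0.
(* Minors that avoid row 0: Cauchy-Binet and the induction hypothesis apply. *)
have shift (l : nat) (rows' cols' : 'I_l -> nat) :
    (l <= q)%N -> (forall i, 0 < rows' i <= n)%N ->
    increasing rows' -> increasing cols' ->
    0 <= minor (recursive_mx r s t) rows' cols'.
  move=> le_lq rows_bd incr_rows incr_cols.
  have rowsE i : (rows' i).-1.+1 = rows' i.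
    by rewrite prednK //; case/andP: (rows_bd i).
  have lt_rows i : ((rows' i).-1 < n)%N.
    by rewrite rowsE; case/andP: (rows_bd i).
  apply: (@minor_prod_ge0 _ (recursive_mx r s t) (coefficient_mx r s t) _ n _
            (fun i => (rows' i).-1)).
  - by move=> i k; rewrite -[in LHS]rowsE; apply: recursive_mxS.
  - move=> g incr_g; apply: IHn => // i j lt_ij.
    by rewrite -ltnS !rowsE; apply: incr_rows.
  - by move=> g incr_g; apply: J_TP.
case: m rows cols le_mq => [|m] rows cols le_mq lt_rows incr_rows incr_cols.
  by rewrite /minor det_mx00 ler01.
have [rows0|rows0] := posnP (rows ord0); last first.
  apply: shift => // i; rewrite -[(_ <= n)%N]ltnS lt_rows andbT.
  case: (unliftP ord0 i) => [j ->|-> //].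
  by apply: leq_trans (incr_rows ord0 _ _); rewrite ?rows0 ?lift0.
(* Row 0 of the recursive matrix is (1, 0, 0, ...): only the first term of the
   expansion along row 0 can be nonzero, and its cofactor has no row 0. *)
rewrite /minor (expand_det_row _ ord0) big_ord_recl big1 ?addr0 => [|j _].
  rewrite mxE rows0; case: (cols ord0) => [|c] /=; last by rewrite mul0r.
  rewrite mul1r /cofactor expr0 mul1r.
  have := @shift m (rows \o lift ord0) (cols \o lift ord0) (ltnW le_mq).
  have -> : minor (recursive_mx r s t) (rows \o lift ord0) (cols \o lift ord0)
    = \det (row' ord0 (col' ord0 (\matrix_(i, j)
              recursive_mx r s t (rows i) (cols j)))).
    by congr (\det _); apply/matrixP => i j; rewrite !mxE.
  apply=> [i|i j lt_ij|i j lt_ij] /=.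
  - by rewrite -[(_ <= n)%N]ltnS lt_rows andbT (leq_trans _ (incr_rows ord0 _ _)).
  - exact: incr_rows.
  - exact: incr_cols.
rewrite !mxE rows0.
by case: (cols (lift ord0 j)) (incr_cols ord0 (lift ord0 j) isT) => //= c _; rewrite mul0r.
Qed.

Lemma TP_upto_recursive_mx (R : realType) (r s t : nat -> R) (q : nat) :
  TP_upto q (coefficient_mx r s t) -> TP_upto q (recursive_mx r s t).
Proof.
move=> J_TP m rows cols le_mq incr_rows incr_cols.
apply: (minor_recursive_mx_ge0 (n := (\max_i rows i).+1) J_TP le_mq) => // i.
by rewrite ltnS; apply: leq_bigmax.
Qed.

Lemma recursive_mx_ge0 (R : realType) (r s t : nat -> R) (n k : nat) :
    (forall k, (1 <= k)%N -> 0 <= r k) -> (forall k, 0 <= s k) ->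
    (forall k, (1 <= k)%N -> 0 <= t k) ->
  0 <= recursive_mx r s t n k.
Proof.
move=> r_ge0 s_ge0 t_ge0.
elim: n k => [|n IHn] [|k] //=; rewrite ?ler01 //.
  by rewrite addr_ge0 ?mulr_ge0 ?t_ge0.
by rewrite !addr_ge0 ?mulr_ge0 ?r_ge0 ?t_ge0.
Qed.

Lemma TP_upto2_mul_le (R : realType) (A : nat -> nat -> R) (i j k l : nat) :
    TP_upto 2 A -> (i < j)%N -> (k < l)%N ->
  A i l * A j k <= A i k * A j l.
Proof.
move=> A_TP lt_ij lt_kl.
pose pair (a b : nat) (x : 'I_2) := if x == ord0 then a else b.
have pair_incr a b : (a < b)%N -> increasing (pair a b).
  by move=> lt_ab [[|[|x]] //= x2] [[|[|y]] //= y2].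
have := A_TP _ _ _ (leqnn 2) (pair_incr _ _ lt_ij) (pair_incr _ _ lt_kl).
rewrite /minor (expand_det_row _ ord0) !big_ord_recl big_ord0 /cofactor.
by rewrite !det_mx11 !mxE /= expr0 expr1 addr0 mul1r mulN1r mulrN subr_ge0.
Qed.

Theorem theorem2p3 (R : realType) (r s t : nat -> R)
    (r_ge0 : forall k : nat, (1 <= k)%N -> 0 <= r k)
    (s_ge0 : forall k : nat, 0 <= s k)
    (t_ge0 : forall k : nat, (1 <= k)%N -> 0 <= t k) :
  ((forall q : nat, (0 < q)%N ->
      TP_upto q (coefficient_mx r s t) -> TP_upto q (recursive_mx r s t)) /\
   (TP (coefficient_mx r s t) -> TP (recursive_mx r s t))) /\
  (TP_upto 2%N (recursive_mx r s t) ->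
    log_convex (fun n : nat => recursive_mx r s t n 0%N)).
Proof.
split; [split|].
- by move=> q _; apply: TP_upto_recursive_mx.
- by move=> J_TP m rows cols; apply: (TP_upto_recursive_mx _ (leqnn m)) => l ? ? _;
     apply: J_TP.
move=> A_TP; split=> [n|i j lt_ij]; first exact: recursive_mx_ge0.
rewrite /= mulrDl mulrDr [_ * (s _ * _)]mulrCA [_ * (t _ * _)]mulrCA -!mulrA.
rewrite lerD2l ler_wpM2l ?t_ge0 //.
exact: TP_upto2_mul_le.
Qed.
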